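(* Suppose that $(X_i)_{i\ge1}$ is a stationary ergodic real-valued process, let $p\in\mathbb{N}$, and let $f:\mathbb{R}^p\to\mathbb{R}$ be a measurable function such that $f(X_1,\ldots,X_p)\in L_1$. Then \[ \frac1n\sum_{i=1}^nf(X_i,\ldots,X_{i+p-1})\longrightarrow E f(X_1,\ldots,X_p) \] almost surely, as $n\to\infty$.
   Context: The process $(X_i)_{i\ge1}$ is ergodic if the shift $(x_i)_{i\ge1}\mapsto(x_{i+1})_{i\ge1}$ is an ergodic transformation of $\mathbb{R}^{\mathbb{N}}$, equipped with the product $\sigma$-field and the law of $(X_i)_{i\ge1}$. *)

(* Defs.v *)
From HB Require Import structures.
From mathcomp Require Import all_boot all_order all_algebra.
From mathcomp Require Import all_classical all_reals all_analysis.
Set Implicit Arguments.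
Unset Strict Implicit.
Unset Printing Implicit Defensive.
Import Order.TTheory GRing.Theory Num.Theory.
Import numFieldNormedType.Exports.

Local Open Scope classical_set_scope.
Local Open Scope ring_scope.
Local Open Scope ereal_scope.

(** The space [T^nat] of sequences with its product sigma-field, i.e. the one
    generated by the one-coordinate cylinders. *)
Definition coordinate_cylinders d (T : measurableType d) : set (set (nat -> T)) :=
  [set A | exists i (B : set T),
     measurable B /\ A = (fun x : nat -> T => x i) @^-1` B].

Definition sequence_space d (T : measurableType d) : Type := nat -> T.

HB.instance Definition _ d (T : measurableType d) :=
  Measurable.copy (sequence_space T)
    (g_sigma_algebraType (@coordinate_cylinders d T)).

Definition sequence_shift d (T : measurableType d) (x : sequence_space T) :
  sequence_space T := fun i => x i.+1.

Section ergodic_transformation.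
Context d (T : measurableType d) (R : realType).

Definition measure_preserving (mu : probability T R) (S : T -> T) : Prop :=
  measurable_fun setT S /\
  forall A, measurable A -> mu (S @^-1` A) = mu A.

Definition ergodic_transformation (mu : probability T R) (S : T -> T) : Prop :=
  measure_preserving mu S /\
  forall A, measurable A -> S @^-1` A = A -> mu A = 0 \/ mu A = 1.

End ergodic_transformation.

(** A process [(X_i)_{i >= 1}] is indexed from 0: [X i] stands for [X_{i+1}]. *)
Section processes.
Context d (T : measurableType d) (R : realType) (P : probability T R).
Variable X : nat -> {RV P >-> R}.

Definition trajectory (w : T) : sequence_space R := fun i => X i w.

Lemma measurable_trajectory : measurable_fun setT trajectory.
Proof.
apply: (measurability (rT := sequence_space R) (@coordinate_cylinders _ R)) => //.
move=> _ [_ [i [B [mB ->]]] <-].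
exact: (measurable_funPT (X i)).
Qed.

HB.instance Definition _ :=
  isMeasurableFun.Build _ _ _ _ trajectory measurable_trajectory.

Definition process_law : probability (sequence_space R) R :=
  distribution P (trajectory : {RV P >-> sequence_space R}).

Definition window (p i : nat) (w : T) : p.-tuple R :=
  [tuple X (i + j)%N w | j < p].

(** Strict stationarity: the finite-dimensional distributions are invariant
    under time shifts. *)
Definition stationary : Prop :=
  forall (p k : nat) (A : set (p.-tuple R)), measurable A ->
    P (window p k @^-1` A) = P (window p 0 @^-1` A).

Definition ergodic_process : Prop :=
  ergodic_transformation process_law (@sequence_shift _ R).

End processes.

(* Main.v *)
Require Import Defs.
From mathcomp Require Import all_boot all_order all_algebra.
From mathcomp Require Import all_classical all_reals all_analysis.
From mathcomp Require Import measurable_realfun lra.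
Import Order.TTheory GRing.Theory Num.Theory.
Import numFieldNormedType.Exports.
Local Open Scope classical_set_scope.
Local Open Scope ring_scope.

(** The statement is Birkhoff's ergodic theorem for the shift on the law of the
    process, pulled back along the trajectory map.

    Let S be ergodic and let h be integrable with negative integral. Let
    [M_n] be the maximum of 0 and of the first n ergodic sums of h. Then
    [M_(n+1) = max(0, h + M_n o S)], so [M_(n+1) - M_n o S = max(- M_n o S, h)],
    which is dominated by |h| and has nonnegative integral because S preserves
    the measure and [M_n] is nondecreasing. The set where [M_n] is unbounded is
    invariant; if it had measure 1, dominated convergence would give
    [\int h >= 0]. Hence it is null, and almost surely the ergodic sums of h are
    bounded above. Applying this to [h = g - c] for [c > \int g], and to -g,
    gives the two halves of the convergence. *)

(** * Change of variables under a measure-preserving map *)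

Section measure_preserving_integral.
Context {d} {T : measurableType d} {R : realType} {mu : probability T R}.
Context {S : T -> T}.
Hypothesis muS : measure_preserving mu S.

(** Taking absolute values avoids assuming integrability, so this can establish integrability of
    [g \o S] before the signed change of variables, which requires it. *)
Lemma measure_preserving_integral_norm (g : T -> \bar R) :
  measurable_fun setT g ->
  (\int[mu]_x `|g (S x)| = \int[mu]_x `|g x|)%E.
Proof.
case: muS => mS pS mg.
have mag : measurable_fun setT (abse \o g) by exact: measurableT_comp.
have := @ge0_integral_pushforward _ _ T T R S mS mu setT _ measurableT mag
  (fun y _ => abse_ge0 _).
rewrite preimage_setT => <-.
by apply: eq_measure_integral => A mA _ /=; rewrite -pS.
Qed.

Lemma measure_preserving_integrable (g : T -> \bar R) :
  mu.-integrable setT g -> mu.-integrable setT (g \o S).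
Proof.
move=> /integrableP[mg ig]; apply/integrableP; split.
  by apply: measurableT_comp => //; exact: muS.1.
by rewrite (measure_preserving_integral_norm g).
Qed.

Lemma measure_preserving_integral (g : T -> \bar R) :
  mu.-integrable setT g -> (\int[mu]_x g (S x) = \int[mu]_x g x)%E.
Proof.
move=> ig; case: muS => mS pS.
have := @integral_pushforward _ _ T T R S mS mu setT g (measurable_int _ ig).
rewrite preimage_setT => <- //; last exact: measure_preserving_integrable.
by apply: eq_measure_integral => A mA _ /=; rewrite -pS.
Qed.

End measure_preserving_integral.

(** * Maximal ergodic sums and the set where they are unbounded *)

Section maximal_sums.
Context {T : Type} {R : realType} (S : T -> T) (h : T -> R).

(** Encoded by the recursion along [S] rather than as a maximum of partial sums, so that the
    increment formula follows by computation. *)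
Fixpoint maximal_sum (n : nat) (x : T) : R :=
  if n is m.+1 then Num.max 0 (h x + maximal_sum m (S x)) else 0.

Lemma maximal_sum_ge0 n x : 0 <= maximal_sum n x.
Proof. by case: n => //= n; rewrite le_max lexx. Qed.

Lemma maximal_sum_nondecreasing x : nondecreasing_seq (maximal_sum ^~ x).
Proof.
apply/nondecreasing_seqP => n; elim: n x => [|n IH] x; first exact: maximal_sum_ge0.
rewrite -[leLHS]/(Num.max 0 (h x + maximal_sum n (S x))).
rewrite -[leRHS]/(Num.max 0 (h x + maximal_sum n.+1 (S x))).
by rewrite ge_max !le_max lexx/= lerD2l IH orbT.
Qed.

Lemma sum_le_maximal_sum n x :
  \sum_(0 <= i < n) h (iter i S x) <= maximal_sum n x.
Proof.
elim: n x => [|n IH] x; first by rewrite big_nil.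
rewrite big_nat_recl//= le_max lerD2l; apply/orP; right.
apply: le_trans (IH (S x)); rewrite le_eqVlt; apply/orP; left; apply/eqP.
by apply: eq_bigr => i _; rewrite -iterSr.
Qed.

Lemma maximal_sum_increment n x :
  maximal_sum n.+1 x - maximal_sum n (S x) = Num.max (- maximal_sum n (S x)) (h x).
Proof. by rewrite /= addr_maxl sub0r addrK. Qed.

Definition unbounded_sums : set T :=
  [set x | forall K : nat, exists n, K%:R < maximal_sum n x].

(** Up to truncation at 0, passing from [S x] to [x] changes the maximal sums by [h x], which does
    not depend on [n]. *)
Lemma unbounded_sums_invariant : S @^-1` unbounded_sums = unbounded_sums.
Proof.
apply/seteqP; split=> x /= Ax K.
  have [n nK] := Ax (Num.truncn (K%:R - h x)).+1.
  exists n.+1; rewrite /= lt_max; apply/orP; right.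
  by have := truncnS_gt (K%:R - h x); lra.
(* The positive part of [h x] keeps this level nonnegative, which rules out both [n = 0] and the
   zero branch of the maximum, and it still absorbs [h x] in the other branch. *)
have [n] := Ax (Num.truncn (K%:R + Num.max 0 (h x))).+1.
move/(lt_trans (truncnS_gt _)); case: n => [|n] /=.
  have : 0 <= K%:R :> R by [].
  have : 0 <= Num.max 0 (h x) by rewrite le_max lexx.
  by lra.
rewrite lt_max => /orP[|]; last first.
  have : h x <= Num.max 0 (h x) by rewrite le_max lexx orbT.
  by exists n; lra.
have : 0 <= K%:R :> R by [].
have : 0 <= Num.max 0 (h x) by rewrite le_max lexx.
by lra.
Qed.

End maximal_sums.

(** * Negative drift makes the maximal sums almost surely bounded *)

Section negative_drift.
Context {d} {T : measurableType d} {R : realType} {mu : probability T R}.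
Context {S : T -> T} {h : T -> R}.
Hypothesis ergS : ergodic_transformation mu S.
Hypothesis ih : mu.-integrable setT (EFin \o h).

Local Notation M := (maximal_sum S h).

Let mh : measurable_fun setT h.
Proof. by apply/measurable_EFinP; exact: measurable_int ih. Qed.

Let mS : measurable_fun setT S. Proof. exact: ergS.1.1. Qed.

Lemma measurable_maximal_sum n : measurable_fun setT (M n).
Proof.
elim: n => [|n IH] /=; first exact: measurable_cst.
apply: measurable_maxr; first exact: measurable_cst.
by apply: measurable_funD => //; exact: measurableT_comp.
Qed.

Lemma integrable_maximal_sum n : mu.-integrable setT (EFin \o M n).
Proof.
elim: n => [|n IH]; first exact: integrable0.
have iD := integrableD measurableT ih (measure_preserving_integrable ergS.1 _ IH).
apply: le_integrable iD => //.
  by apply/measurable_EFinP; exact: measurable_maximal_sum.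
move=> x _ /=; rewrite lee_fin ger0_norm ?maximal_sum_ge0//.
  by rewrite ge_max normr_ge0 ler_norm.
by rewrite le_max lexx.
Qed.

Lemma measurable_unbounded_sums : measurable (unbounded_sums S h).
Proof.
rewrite [X in measurable X](_ : _ =
  \bigcap_(K : nat) \bigcup_(n : nat) (M n @^-1` `]K%:R, +oo[)); last first.
  apply/seteqP; split=> x /= Ax K.
    by move=> _; have [n ?] := Ax K; exists n => //=; rewrite in_itv/= andbT.
  by have [n _ /=] := Ax K I; rewrite in_itv/= andbT; exists n.
apply: bigcapT_measurable => K; apply: bigcupT_measurable => n.
by rewrite -[X in measurable X]setTI; exact: measurable_maximal_sum.
Qed.

Lemma integral_increment_ge0 n :
  (0 <= \int[mu]_x (Num.max (- M n (S x)) (h x))%:E)%E.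
Proof.
under eq_integral do rewrite -maximal_sum_increment EFinB.
rewrite integralB_EFin//; [|exact: integrable_maximal_sum|]; last first.
  exact: (measure_preserving_integrable ergS.1 _ (integrable_maximal_sum n)).
rewrite (measure_preserving_integral ergS.1 (EFin \o M n)); last first.
  exact: integrable_maximal_sum.
rewrite sube_ge0; last first.
  by apply/orP; left; apply: integrable_fin_num => //; exact: integrable_maximal_sum.
apply: le_integral => //; [exact: integrable_maximal_sum..|].
by move=> x _; rewrite lee_fin; exact: maximal_sum_nondecreasing.
Qed.

Lemma unbounded_sums_null :
  (\int[mu]_x (h x)%:E < 0)%E -> mu (unbounded_sums S h) = 0%E.
Proof.
move=> h_lt0.
have mA := measurable_unbounded_sums.
have [//|muA1] := ergS.2 _ mA (unbounded_sums_invariant S h).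
(* The exceptional set is the complement of the unbounded set; invariance replaces [S x] by [x]. *)
have Aae : {ae mu, forall x, unbounded_sums S h (S x)}.
  exists (~` unbounded_sums S h); split; first exact: measurableC.
    by rewrite probability_setC// muA1 subee.
  by move=> x /= + Ax; rewrite -[X in ~ X]/((S @^-1` unbounded_sums S h) x)
    unbounded_sums_invariant.
(* Once [M n (S x)] exceeds [- h x], monotonicity keeps it there, so the sequence is eventually
   constant. *)
have cvh x : unbounded_sums S h (S x) ->
    (Num.max (- M n (S x)) (h x))%:E @[n --> \oo] --> (h x)%:E.
  move=> /(_ (Num.truncn (- h x)).+1)[n /(lt_trans (truncnS_gt _)) hM].
  apply: cvg_near_cst; near=> k; apply/congr1/max_idPr.
  rewrite lerNl; apply/ltW/(lt_le_trans hM)/maximal_sum_nondecreasing.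
  by near: k; exact: nbhs_infty_ge.
have [] := @dominated_convergence _ T R mu setT measurableT
  (fun n x => (Num.max (- M n (S x)) (h x))%:E) (EFin \o h) (abse \o (EFin \o h)).
- move=> n; apply/measurable_EFinP/measurable_maxr => //.
  apply: measurableT_comp => //.
  by apply: measurableT_comp => //; exact: measurable_maximal_sum.
- exact: measurable_int ih.
- by apply: filterS Aae => x /cvh.
- exact: integrable_abse.
- apply: aeW => x n _; rewrite lee_fin /=.
  have := maximal_sum_ge0 S h n (S x); set m := M n (S x) => m0.
  (* In the remaining case [h x < - m <= 0], hence [m] is below the absolute value of [h x]. *)
  by case: (leP (- m) (h x)) => // hm; rewrite ler_norml; apply/andP; split;
    have := ler_norm (h x); have := ler_norm (- h x); rewrite normrN; lra.
move=> _ _ cv; move: h_lt0; rewrite ltNge => /negP[].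
apply: cvge_ge cv; near=> n; exact: integral_increment_ge0.
Unshelve. all: end_near.
Qed.

End negative_drift.

(** * Birkhoff's pointwise ergodic theorem *)

Section pointwise_ergodic_theorem.
Context {d} {T : measurableType d} {R : realType} {mu : probability T R}.
Context {S : T -> T}.
Hypothesis ergS : ergodic_transformation mu S.

(** The maximal sums of [g - c] have negative drift, so almost surely a single [K] bounds them all.
    As [K] may depend on [x] but not on [n], it disappears after division by [n]. *)
Lemma ergodic_sum_upper_bound (g : T -> R) (c : R) :
  mu.-integrable setT (EFin \o g) -> (\int[mu]_x (g x)%:E < c%:E)%E ->
  {ae mu, forall x, exists K : R,
    forall n, \sum_(0 <= i < n) g (iter i S x) <= n%:R * c + K}.
Proof.
move=> ig gc; pose h x := g x - c.
have ic : mu.-integrable setT (EFin \o cst c).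
  exact: finite_measure_integrable_cst.
have ih : mu.-integrable setT (EFin \o h) by exact: integrableB ig ic.
have h_lt0 : (\int[mu]_x (h x)%:E < 0)%E.
  under eq_integral do rewrite /h EFinB.
  have intc : (\int[mu]_x (cst c x)%:E = c%:E)%E.
    by rewrite -[RHS](expectation_cst mu) unlock.
  rewrite integralB_EFin// intc.
  by rewrite suber_lt0.
exists (unbounded_sums S h); split; first exact: (measurable_unbounded_sums ergS ih).
  exact: (unbounded_sums_null ergS ih).
move=> x /=; apply: contra_notP => /existsNP[K /forallNP Kx].
exists K%:R => n.
have := sum_le_maximal_sum S h n x.
rewrite /h sumrB big_const_nat iter_addr_0 subn0 -mulr_natl.
by move: (Kx n) => /negP; rewrite -leNgt; lra.
Qed.

Theorem birkhoff_ergodic (g : T -> R) :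
  mu.-integrable setT (EFin \o g) ->
  {ae mu, forall x,
    (n%:R^-1 * \sum_(0 <= i < n) g (iter i S x))%:E @[n --> \oo] -->
      (\int[mu]_y (g y)%:E)%E}.
Proof.
move=> ig.
have intg : (\int[mu]_y (g y)%:E)%E \is a fin_num by exact: integrable_fin_num.
rewrite -(fineK intg); set m := fine _.
(* Countably many slacks [k.+1%:R^-1] suffice, so one null set serves them all; the bound for [-g]
   is the lower bound for [g]. *)
have upper k := ergodic_sum_upper_bound g (m + k.+1%:R^-1) ig.
have lower k := ergodic_sum_upper_bound (\- g) (- m + k.+1%:R^-1) (integrableN ig).
have {}upper : {ae mu, forall x k, exists K : R, forall n,
    \sum_(0 <= i < n) g (iter i S x) <= n%:R * (m + k.+1%:R^-1) + K}.
  apply: ae_foralln => k; apply: upper.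
  by rewrite -(fineK intg) lte_fin ltrDl.
have {}lower : {ae mu, forall x k, exists K : R, forall n,
    \sum_(0 <= i < n) - g (iter i S x) <= n%:R * (- m + k.+1%:R^-1) + K}.
  apply: ae_foralln => k; apply: lower => /=.
  under eq_integral do rewrite EFinN.
  rewrite integralN; last exact: integrable_add_def.
  by rewrite -(fineK intg) lte_fin ltrDl.
apply: filterS2 upper lower => x ub lb.
apply: cvg_EFin; first by near=> n.
apply/cvgrPdist_le => e e0.
(* One half of [e] absorbs the slack, the other half absorbs [K1 / n] and [K2 / n] for large [n]. *)
pose k := Num.truncn (2 / e).
have ke : k.+1%:R^-1 < e / 2.
  by rewrite invf_plt ?posrE ?divr_gt0// invf_div truncnS_gt.
have [K1 HK1] := ub k; have [K2 HK2] := lb k.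
near=> n.
have n0 : 0 < n%:R :> R.
  by rewrite ltr0n; near: n; exact: nbhs_infty_gt.
have nK1 : K1 <= n%:R * (e / 2).
  rewrite -ler_pdivrMr ?divr_gt0//; near: n; exact: nbhs_infty_ger.
have nK2 : K2 <= n%:R * (e / 2).
  rewrite -ler_pdivrMr ?divr_gt0//; near: n; exact: nbhs_infty_ger.
move: (HK1 n) (HK2 n); rewrite sumrN; set s := \sum_(0 <= i < n) _ => s1 s2.
have nke : n%:R * k.+1%:R^-1 <= n%:R * (e / 2).
  by rewrite ler_pM2l// ltW.
(* Multiplying by [n] and generalizing the products leaves inequalities that are linear in the
   remaining atoms. *)
rewrite -(ler_pM2l n0) -[X in X * `|_|](gtr0_norm n0) -normrM mulrBr mulVKf ?gt_eqF//.
rewrite -/s {1}(splitr e) mulrDr.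
move: s1 s2; rewrite !mulrDr mulrN.
move: nke nK1 nK2; move: (n%:R * (e / 2)) (n%:R / _) (n%:R * m) => a b c.
by rewrite ler_norml => ? ? ? ? ?; apply/andP; split; lra.
Unshelve. all: end_near.
Qed.

End pointwise_ergodic_theorem.

(** * From the shift on sequence space back to the process *)

Lemma iter_sequence_shift {d} {T : measurableType d} (i j : nat)
  (x : sequence_space T) : iter i (@sequence_shift _ T) x j = x (i + j)%N.
Proof. by elim: i j => //= i IH j; rewrite /sequence_shift IH addnS. Qed.

Lemma measurable_coordinate {d} {T : measurableType d} (j : nat) :
  measurable_fun setT (fun x : sequence_space T => x j).
Proof.
move=> _ B mB; rewrite setTI; apply: sub_sigma_algebra.
by exists j, B.
Qed.

Theorem proposition5p1 (R : realType) (d : measure_display)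
  (T : measurableType d) (P : probability T R) (X : nat -> {RV P >-> R})
  (hstat : stationary X) (herg : ergodic_process X)
  (p : nat) (f : p.-tuple R -> R)
  (mf : measurable_fun setT f)
  (hf : (fun w : T => f (window X p 0 w)) \in Lfun P 1) :
  {ae P, forall w : T,
    (n%:R^-1 * \sum_(0 <= i < n) f (window X p i w))%:E @[n --> \oo] -->
      'E_P[fun w' : T => f (window X p 0 w')]%E}.
Proof.
(* Reading the first [p] coordinates after [i] shifts gives the window starting at [i]. *)
pose g (x : sequence_space R) := f [tuple x j | j < p].
have mg : measurable_fun setT g.
  apply: measurableT_comp mf _; apply/measurable_fun_tnthP => j.
  rewrite (_ : _ \o _ = fun x : sequence_space R => x j).
    exact: measurable_coordinate.
  by apply/funext => x /=; rewrite tnth_mktuple.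
have mt := measurable_trajectory X.
have mEg : measurable_fun setT (EFin \o g) by exact/measurable_EFinP.
(* Since [0 + j] computes to [j], [g] along the trajectory is convertible to [f] of the window at
   0. *)
have iP : P.-integrable setT (EFin \o g \o trajectory X).
  exact/Lfun1_integrable.
have ig : (process_law X).-integrable setT (EFin \o g).
  exact: integrable_pushforward.
have gw i w : g (iter i (@sequence_shift _ R) (trajectory X w)) = f (window X p i w).
  by congr f; apply: eq_mktuple => j; rewrite iter_sequence_shift.
have Eg : (\int[process_law X]_y (g y)%:E)%E = 'E_P[fun w => f (window X p 0 w)]%E.
  rewrite unlock; exact: (integral_pushforward mt).
have [N [mN N0 subN]] := birkhoff_ergodic herg g ig.
exists (trajectory X @^-1` N); split.
- by rewrite -[X in measurable X]setTI; exact: mt.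
(* By definition the law of the process gives [N] the [P]-measure of its preimage under the
   trajectory map. *)
- exact: N0.
- move=> w /= Nw; apply: subN => /= cv; apply: Nw; rewrite -Eg.
  by under eq_fun do under eq_bigr do rewrite -gw.
Qed.
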